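(* Let $d\ge 1$, $\gamma\ge 1$, let $\mathbb P$ be a probability measure on $\mathbb R^d\times\mathbb R^d$, let $(X,Y)\sim\mathbb P$ and suppose that $\mathbb E[|(X,Y)|_2^\gamma]<\infty$. Then $$\mathrm{MPD}(\mathbb P,\gamma)=2^{1-\gamma}\,\mathbb E\big[\,|X-\mathbb E[Y|X]|_2^\gamma\,\big].$$
   Context: $|\cdot|_2$ is the Euclidean norm. For probability measures $\mathbb P,\mathbb Q$ on $\mathbb R^d\times\mathbb R^d$, a probability measure $\pi$ on $(\mathbb R^d)^4$, with $(X,Y,X',Y')\sim\pi$, is a bi-causal coupling of $\mathbb P$ and $\mathbb Q$ if $(X,Y)\sim\mathbb P$, $(X',Y')\sim\mathbb Q$, $\mathrm{Law}(Y|X,X')=\mathrm{Law}(Y|X)$ and $\mathrm{Law}(Y'|X,X')=\mathrm{Law}(Y'|X')$. The adapted Wasserstein distance is defined by $$\mathcal{AW}_\gamma(\mathbb P,\mathbb Q)^\gamma=\inf\{\mathbb E[|Y-Y'|_2^\gamma+|X-X'|_2^\gamma]:\ (X,Y,X',Y')\sim\pi,\ \pi\text{ a bi-causal coupling of }\mathbb P\text{ and }\mathbb Q\}.$$ The martingale projection distance is $$\mathrm{MPD}(\mathbb P,\gamma)=\inf\{\mathcal{AW}_\gamma(\mathbb P,\mathbb Q)^\gamma:\ \mathbb Q\text{ a probability measure on }\mathbb R^d\times\mathbb R^d\text{ with }\mathbb E[Y'|X']=X'\text{ for }(X',Y')\sim\mathbb Q\}.$$ *)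

(* Defs.v *)
From HB Require Import structures.
From mathcomp Require Import all_boot all_order all_algebra.
From mathcomp Require Import all_classical all_reals all_analysis.

Set Implicit Arguments.
Unset Strict Implicit.
Unset Printing Implicit Defensive.

Import Order.TTheory GRing.Theory Num.Theory.
Import numFieldNormedType.Exports.
Local Open Scope classical_set_scope.
Local Open Scope ring_scope.

(* [d.-tuple R] carries the product of the Borel sigma-algebras of [R], which
   is the Borel sigma-algebra of R^d. *)
Notation vec R d := (d.-tuple R).

Definition tsub (R : realType) (d : nat) (x y : vec R d) : vec R d :=
  [tuple tnth x i - tnth y i | i < d].

Definition enorm (R : realType) (d : nat) (x : vec R d) : R :=
  Num.sqrt (\sum_(i < d) tnth x i ^+ 2).

Section conditioning.
Context d1 d2 (T : measurableType d1) (T' : measurableType d2) (R : realType).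
Variables (P : probability T R) (Z : T -> T').

(* [W] is a version of E[V | Z]: it is sigma(Z)-measurable, and has the same
   integral as [V] on each event of sigma(Z). *)
Definition is_cond_exp (V W : T -> R) : Prop :=
  [/\ P.-integrable setT (EFin \o V),
      P.-integrable setT (EFin \o W),
      measurable_fun [set: g_sigma_algebra_preimageType Z]
        (W : g_sigma_algebra_preimageType Z -> R)
    & forall A, g_sigma_algebra_preimage Z A ->
        (\int[P]_(w in A) (W w)%:E = \int[P]_(w in A) (V w)%:E)%E].

(* A version of E[V | Z]; versions exist as soon as [V] is integrable, and any
   two of them are almost surely equal. *)
Definition cond_exp (V : T -> R) : T -> R :=
  xget (fun=> 0) [set W | is_cond_exp V W].

(* E[Y | Z] for a random vector [Y]. *)
Definition cond_expv (d : nat) (Y : T -> vec R d) (w : T) : vec R d :=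
  [tuple cond_exp (fun u => tnth (Y u) i) w | i < d].

(* Law(Y | Z), as the family of conditional probabilities P(Y \in B | Z). *)
Definition cond_law d3 (T'' : measurableType d3) (Y : T -> T'')
    (B : set T'') : T -> R :=
  cond_exp (\1_(Y @^-1` B)).

End conditioning.

(* Law(Y | Z1) = Law(Y | Z2): for each event [B], the conditional
   probabilities of [Y \in B] agree almost surely. For [Y] valued in R^d, this is
   the same as almost sure equality of the regular conditional laws. *)
Definition eq_cond_law d0 d1 d2 d3 (T : measurableType d0)
    (T1 : measurableType d1) (T2 : measurableType d2) (T3 : measurableType d3)
    (R : realType) (P : probability T R) (Y : T -> T3)
    (Z1 : T -> T1) (Z2 : T -> T2) : Prop :=
  forall B, measurable B ->
    \forall w \ae P, cond_law P Z1 Y B w = cond_law P Z2 Y B w.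

Definition has_law d1 d2 (T : measurableType d1) (T' : measurableType d2)
    (R : realType) (P : probability T R) (Z : T -> T')
    (Q : probability T' R) : Prop :=
  forall A, measurable A -> P (Z @^-1` A) = Q A.

(* The law of a one-step path is a measure on [step_path R d], whose points are
   (x, y); a coupling of two such laws is a measure on
   [step_path R d * step_path R d], whose points are ((x, y), (x', y')). *)
Notation step_path R d := (vec R d * vec R d)%type.

Section adapted_wasserstein.
Context (R : realType) (d : nat).
Implicit Types (P Q : probability (step_path R d) R)
  (Pi : probability (step_path R d * step_path R d)%type R).

Definition bicausal P Q Pi : Prop :=
  let X := fun w : step_path R d * step_path R d => w.1.1 in
  let Y := fun w : step_path R d * step_path R d => w.1.2 in
  let X' := fun w : step_path R d * step_path R d => w.2.1 in
  let Y' := fun w : step_path R d * step_path R d => w.2.2 in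
  [/\ has_law Pi (fun w => (X w, Y w)) P,
      has_law Pi (fun w => (X' w, Y' w)) Q,
      eq_cond_law Pi Y (fun w => (X w, X' w)) X
    & eq_cond_law Pi Y' (fun w => (X w, X' w)) X'].

Definition aw_cost (gamma : R) Pi : \bar R :=
  (\int[Pi]_w (enorm (tsub w.1.2 w.2.2) `^ gamma
             + enorm (tsub w.1.1 w.2.1) `^ gamma)%:E)%E.

(* This is AW_gamma(P, Q)^gamma, not AW_gamma(P, Q). *)
Definition aw_pow (gamma : R) P Q : \bar R :=
  ereal_inf [set aw_cost gamma Pi | Pi in [set Pi | bicausal P Q Pi]].

(* E[Y' | X'] = X' almost surely, for (X', Y') of law [Q], that is, X' is a
   version of E[Y' | X']; this includes the integrability of Y'. *)
Definition martingale_law Q : Prop :=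
  forall i : 'I_d, is_cond_exp Q (fun w => w.1)
    (fun w => tnth w.2 i) (fun w => tnth w.1 i).

Definition mpd P (gamma : R) : \bar R :=
  ereal_inf [set aw_pow gamma P Q | Q in [set Q | martingale_law Q]].

End adapted_wasserstein.

(* Main.v *)
Require Import Defs.
From HB Require Import structures.
From mathcomp Require Import all_boot all_order all_algebra.
From mathcomp Require Import all_classical all_reals all_analysis.
From mathcomp Require Import measurable_realfun finmap ring lra.

Set Implicit Arguments.
Unset Strict Implicit.
Unset Printing Implicit Defensive.

Import Order.TTheory GRing.Theory Num.Theory.
Import numFieldNormedType.Exports.
Local Open Scope classical_set_scope.
Local Open Scope ring_scope.

(** Write m(X) for E[Y | X] and c for the half gap (m(X) - X) / 2. Since
    2^(1 - gamma) |X - m(X)|^gamma = 2 |c|^gamma, the claim is that the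
    distance equals E[2 |c|^gamma].

    Lower bound. Let (X, Y, X', Y') follow a bi-causal coupling of P with a
    martingale law. The convex function |.|^gamma lies above its tangent at c,
    with gradient g(c); use this for Y - Y' and for X' - X and add:
    |Y - Y'|^gamma + |X - X'|^gamma
      >= 2 |c|^gamma + <g(c), (Y - m(X)) - (Y' - X')>,
    because (Y - Y') + (X' - X) - 2c = (Y - m(X)) - (Y' - X'). The inner
    product has expectation zero: g(c) is a function of X, E[Y | X] = m(X), and
    E[Y' | X, X'] = E[Y' | X'] = X' by causality and the martingale property.
    Working with one common tangent at c replaces both the conditional Jensen
    inequality and the triangle inequality. As g(c) need not be bounded, one
    truncates in X and lets the truncation grow ([half_gap_le_aw_cost]). The
    passage from equal conditional laws to equal conditional expectations is
    [eq_cond_law_integral].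

    Upper bound. The midpoint X' = (X + m(X)) / 2 with Y' = Y - m(X) + X' has the
    right cost and E[Y' | X] = X', but X' may forget part of X, and then
    Law(Y' | X, X') differs from Law(Y' | X'). So the midpoint is rounded to a
    fine grid and the position inside the grid cell is used to store X,
    coordinate by coordinate, through an injection of R into ]0, 1[. The
    resulting X' generates the same sigma-algebra as X, which makes the coupling
    bi-causal ([eq_cond_law_ae_fun]), and its cost tends to E[2 |c|^gamma] as the
    grid gets finer ([mpd_le], [le_of_vanishing_slack]). *)
(** * Euclidean norms and their powers *)

Section euclidean_norm.
Context (R : realType) (d : nat).
Implicit Types (x y u v w : vec R d) (gamma : R).

Lemma enorm_ge0 x : 0 <= enorm x.
Proof. exact: sqrtr_ge0. Qed.

Lemma sqr_enorm x : enorm x ^+ 2 = \sum_(i < d) tnth x i ^+ 2.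
Proof. by rewrite sqr_sqrtr// sumr_ge0// => i _; exact: sqr_ge0. Qed.

Lemma tnth_tsub x y i : tnth (tsub x y) i = tnth x i - tnth y i.
Proof. by rewrite tnth_mktuple. Qed.

Lemma normr_tnth_le_enorm x i : `|tnth x i| <= enorm x.
Proof.
rewrite -sqrtr_sqr; apply: ler_wsqrtr; rewrite (bigD1 i)//= lerDl.
by apply: sumr_ge0 => j _; exact: sqr_ge0.
Qed.

Lemma eq_enorm x y : (forall i, tnth x i ^+ 2 = tnth y i ^+ 2) ->
  enorm x = enorm y.
Proof. by move=> xy; rewrite /enorm; under eq_bigr do rewrite xy. Qed.

Lemma enorm_eq0P x : enorm x = 0 <-> forall i, tnth x i = 0.
Proof.
split=> [x0 i|x0]; first by apply/eqP; rewrite -normr_le0 -x0 normr_tnth_le_enorm.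
by rewrite /enorm big1 ?sqrtr0// => i _; rewrite x0 expr0n.
Qed.

Lemma enorm_tsub_eq0 x y : enorm (tsub x y) = 0 -> x = y.
Proof.
move=> /enorm_eq0P xy; apply: eq_from_tnth => i.
by apply/eqP; rewrite -subr_eq0 -tnth_tsub xy.
Qed.

(** A crude bound, enough to turn a coordinatewise grid size into a norm. *)
Lemma enorm_le_bound x (e : R) : 0 <= e ->
  (forall i, `|tnth x i| <= e / d%:R) -> enorm x <= e.
Proof.
move=> e0 xe; rewrite -[leRHS](ger0_norm e0) -sqrtr_sqr; apply: ler_wsqrtr.
have [d0|d0] := posnP d.
  by rewrite big1 ?sqr_ge0// => i; have := ltn_ord i; rewrite {2}d0.
have dR0 : 0 < d%:R :> R by rewrite ltr0n.
apply: (@le_trans _ _ (\sum_(i < d) e * (e / d%:R))); last first.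
  by rewrite sumr_const card_ord -[_ *+ d]mulr_natr -mulrA divfK ?gt_eqF.
apply: ler_sum => i _; rewrite -real_normK ?num_real// expr2.
apply: ler_pM => //; apply: le_trans (xe i) _.
by rewrite ler_pdivrMr// ler_peMr// ler1n.
Qed.

(** Cauchy-Schwarz, from the nonnegative sum of squares of the coordinates of
    |y| x - |x| y. *)
Lemma dot_le_enorm x y :
  \sum_(i < d) tnth x i * tnth y i <= enorm x * enorm y.
Proof.
have [x0|x0] := eqVneq (enorm x) 0.
  by rewrite x0 mul0r big1// => i _; rewrite (enorm_eq0P x).1// mul0r.
have [y0|y0] := eqVneq (enorm y) 0.
  by rewrite y0 mulr0 big1// => i _; rewrite ((enorm_eq0P y).1 y0) mulr0.
set a := enorm x in x0 *; set b := enorm y in y0 *.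
have a0 : 0 < a by rewrite lt0r x0 enorm_ge0.
have b0 : 0 < b by rewrite lt0r y0 enorm_ge0.
have : 0 <= \sum_(i < d) (b * tnth x i - a * tnth y i) ^+ 2.
  by apply: sumr_ge0 => i _; exact: sqr_ge0.
have -> : \sum_(i < d) (b * tnth x i - a * tnth y i) ^+ 2 =
   b ^+ 2 * (\sum_(i < d) tnth x i ^+ 2) + a ^+ 2 * (\sum_(i < d) tnth y i ^+ 2)
   - 2 * a * b * (\sum_(i < d) tnth x i * tnth y i).
  rewrite !mulr_sumr -big_split/= -sumrB; apply: eq_bigr => i _; ring.
rewrite -!sqr_enorm -/a -/b.
have -> : b ^+ 2 * a ^+ 2 + a ^+ 2 * b ^+ 2 -
    2 * a * b * (\sum_(i < d) tnth x i * tnth y i) =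
  (2 * (a * b)) * (a * b - \sum_(i < d) tnth x i * tnth y i) by ring.
by rewrite pmulr_rge0 ?subr_ge0// mulr_gt0// mulr_gt0.
Qed.

Lemma enormB_le u v : enorm u - enorm v <= enorm (tsub u v).
Proof.
have [u0|u0] := eqVneq (enorm u) 0.
  by rewrite u0 sub0r (le_trans _ (enorm_ge0 _))// oppr_le0 enorm_ge0.
have {}u0 : 0 < enorm u by rewrite lt0r u0 enorm_ge0.
rewrite -(ler_pM2l u0) mulrBr lerBlDl.
apply: le_trans (lerD (dot_le_enorm u v) (dot_le_enorm u (tsub u v))).
rewrite -big_split/= -expr2 sqr_enorm ler_sum// => i _.
by rewrite tnth_tsub; lra.
Qed.

End euclidean_norm.

Section power_of_norm.
Context (R : realType) (gamma : R).
Hypothesis gamma1 : 1 <= gamma.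

Lemma exponent_gt0 : 0 < gamma. Proof. exact: lt_le_trans gamma1. Qed.

(** The tangent line of the convex function r^gamma, in the form of Young's
    inequality for the product s r^(gamma - 1). *)
Lemma powR_tangent (r s : R) : 0 <= r -> 0 <= s ->
  gamma * r `^ (gamma - 1) * (s - r) <= s `^ gamma - r `^ gamma.
Proof.
move=> r0 s0; have g0 := exponent_gt0.
have [g1|g1] := eqVneq gamma 1.
  by rewrite g1 subrr powRr0 !powRr1// !mul1r.
have gm1 : 0 < gamma - 1 by rewrite subr_gt0 lt_neqAle eq_sym g1.
(* the second factor is raised to the conjugate exponent gamma / (gamma - 1),
   which gives back r^gamma *)
have := @conjugate_powR _ s (r `^ (gamma - 1)) gamma (gamma / (gamma - 1))
  s0 (powR_ge0 _ _) g0 (divr_gt0 g0 gm1).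
have -> : gamma^-1 + (gamma / (gamma - 1))^-1 = 1.
  by field; rewrite !gt_eqF.
rewrite -powRrM mulrCA divff ?gt_eqF// mulr1 => /(_ erefl) young.
rewrite mulrBr -[_ * _ * r]mulrA [r `^ _ * r]mulrC mulr_powRB1//.
have : gamma * (s * r `^ (gamma - 1)) <=
    gamma * (s `^ gamma / gamma + r `^ gamma / (gamma / (gamma - 1))).
  by rewrite ler_pM2l.
have -> : gamma * (s `^ gamma / gamma + r `^ gamma / (gamma / (gamma - 1))) =
    s `^ gamma + (gamma - 1) * r `^ gamma.
  by field; rewrite !gt_eqF.
lra.
Qed.

Lemma le_1DpowR (r : R) : 0 <= r -> r <= 1 + r `^ gamma.
Proof.
move=> r0; have [r1|r1] := leP r 1; first by rewrite ler_wpDr ?powR_ge0.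
by apply: le_trans (le1r_powR (ltW r1) gamma1) _; rewrite lerDr.
Qed.

Lemma powRB1_le_1DpowR (r : R) : 0 <= r -> r `^ (gamma - 1) <= 1 + r `^ gamma.
Proof.
move=> r0; have [r1|r1] := leP r 1.
  rewrite ler_wpDr ?powR_ge0//.
  have := @ge0_ler_powR R (gamma - 1) _ r 1.
  by rewrite powR1; apply; rewrite ?nnegrE ?subr_ge0.
rewrite ler_wpDl//; apply: ler_powR; first exact: ltW.
by rewrite lerBlDr lerDl.
Qed.

(** The gradient of |v|^gamma. At v = 0 the last factor makes it zero, which is
    a subgradient there for every gamma >= 1. *)
Definition powgrad d (v : vec R d) (i : 'I_d) : R :=
  gamma * enorm v `^ (gamma - 2) * tnth v i.

(** The scalar tangent inequality at r = |v|, s = |w|, since Cauchy-Schwarz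
    gives <v, w - v> <= |v| (|w| - |v|). *)
Lemma enorm_powR_tangent d (v w : vec R d) :
  enorm v `^ gamma + \sum_(i < d) powgrad v i * (tnth w i - tnth v i)
    <= enorm w `^ gamma.
Proof.
have g0 := exponent_gt0.
have [v0|v0] := eqVneq (enorm v) 0.
  rewrite v0 powR0 ?gt_eqF// add0r big1 ?powR_ge0// => i _.
  by rewrite /powgrad ((enorm_eq0P v).1 v0) mulr0 mul0r.
have {}v0 : 0 < enorm v by rewrite lt0r v0 enorm_ge0.
rewrite -lerBrDl.
apply: le_trans (powR_tangent (enorm_ge0 v) (enorm_ge0 w)).
have -> : \sum_(i < d) powgrad v i * (tnth w i - tnth v i) =
    gamma * enorm v `^ (gamma - 2) *
      (\sum_(i < d) tnth v i * tnth w i - enorm v ^+ 2).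
  rewrite sqr_enorm -sumrB mulr_sumr; apply: eq_bigr => i _.
  by rewrite /powgrad; ring.
have -> : enorm v `^ (gamma - 1) = enorm v `^ (gamma - 2) * enorm v.
  rewrite -[X in _ * X]powRr1 ?enorm_ge0// -powRD; last by rewrite (gt_eqF v0) implybT.
  by congr (_ `^ _); ring.
rewrite -!mulrA ler_pM2l// ler_pM2l ?powR_gt0//.
by rewrite mulrBr -expr2 lerD2r dot_le_enorm.
Qed.

(** The effect of a small displacement on the cost: the tangent at |u| bounds
    the loss by s |u|^(gamma - 1), which is at most s (1 + |u|^gamma). No uniform
    modulus of continuity is available, hence the relative error s on the left. *)
Lemma enorm_powR_perturb d (u c : vec R d) (s : R) :
  enorm (tsub u c) <= s / gamma ->
  (1 - s) * enorm u `^ gamma <= enorm c `^ gamma + s.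
Proof.
move=> ucs; have g0 := exponent_gt0.
have u0 := enorm_ge0 u; have c0 := enorm_ge0 c.
have tg := powR_tangent u0 c0.
have p0 : 0 <= enorm u `^ (gamma - 1) by exact: powR_ge0.
have s0 : 0 <= s by have := le_trans (enorm_ge0 _) ucs; rewrite pmulr_lge0 ?invr_gt0.
have h : gamma * (enorm u - enorm c) <= s.
  by rewrite mulrC -ler_pdivlMr//; exact: le_trans (enormB_le u c) ucs.
have h1 : enorm u `^ (gamma - 1) * (gamma * (enorm u - enorm c)) <=
   enorm u `^ (gamma - 1) * s by rewrite ler_wpM2l.
have h2 : enorm u `^ (gamma - 1) * s <= (1 + enorm u `^ gamma) * s.
  by rewrite ler_wpM2r// powRB1_le_1DpowR.
move: tg h1 h2; clear; set p := enorm u `^ (gamma - 1).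
move: (enorm u) (enorm c) (enorm u `^ _) (enorm c `^ _) p => a b A B p; lra.
Qed.

End power_of_norm.

Section measurability.
Context (R : realType) (d : nat) disp (T : measurableType disp).

Lemma measurable_mktuple (f : 'I_d -> T -> R) :
  (forall i, measurable_fun setT (f i)) ->
  measurable_fun setT (fun w => [tuple f i w | i < d]).
Proof.
move=> mf; apply/measurable_fun_tnthP => i.
by apply: eq_measurable_fun (mf i) => w _ /=; rewrite tnth_mktuple.
Qed.

Lemma measurable_tnth_comp (v : T -> vec R d) i :
  measurable_fun setT v -> measurable_fun setT (fun w => tnth (v w) i).
Proof. by move=> /measurable_fun_tnthP; apply. Qed.

Lemma measurable_tsub (u v : T -> vec R d) : measurable_fun setT u ->
  measurable_fun setT v -> measurable_fun setT (fun w => tsub (u w) (v w)).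
Proof.
move=> mu mv; apply: measurable_mktuple => i.
by apply: measurable_funB; exact: measurable_tnth_comp.
Qed.

Lemma measurable_enorm (v : T -> vec R d) : measurable_fun setT v ->
  measurable_fun setT (fun w => enorm (v w)).
Proof.
move=> mv; apply: (measurableT_comp (f := @Num.sqrt R)).
  by apply: continuous_measurable_fun; exact: sqrt_continuous.
by apply: measurable_sum => i; apply: measurable_funX; exact: measurable_tnth_comp.
Qed.

Lemma measurable_enorm_powR (v : T -> vec R d) (gamma : R) :
  measurable_fun setT v -> measurable_fun setT (fun w => enorm (v w) `^ gamma).
Proof.
move=> mv; apply: (measurableT_comp (measurable_powR gamma)).
exact: measurable_enorm.
Qed.

End measurability.

(** * Versions of a conditional expectation *)
Section conditional_expectation.
Context d1 d2 (T : measurableType d1) (T' : measurableType d2) (R : realType).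
Variables (P : probability T R) (Z : T -> T').
Hypothesis mZ : measurable_fun setT Z.
Implicit Types V W : T -> R.

Lemma measurable_preimage (B : set T') : measurable B -> measurable (Z @^-1` B).
Proof. by move=> mB; rewrite -[_ @^-1` _]setTI; exact: mZ. Qed.

Lemma measurable_g_sigma_algebra_preimage (A : set T) :
  g_sigma_algebra_preimage Z A -> measurable A.
Proof. by case=> B mB <-; rewrite setTI; exact: measurable_preimage. Qed.

Lemma is_cond_exp_integral V W B : is_cond_exp P Z V W -> measurable B ->
  (\int[P]_(w in Z @^-1` B) (W w)%:E = \int[P]_(w in Z @^-1` B) (V w)%:E)%E.
Proof. by move=> [_ _ _ +] mB; apply; exists B => //; rewrite setTI. Qed.

(** A measurable function of Z is sigma(Z)-measurable, and every event of
    sigma(Z) is a preimage under Z, so only the averaging identity over such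
    preimages has to be checked. *)
Lemma is_cond_exp_factor V (k : T' -> R) : measurable_fun setT k ->
  P.-integrable setT (EFin \o V) -> P.-integrable setT (EFin \o (k \o Z)) ->
  (forall B, measurable B -> (\int[P]_(w in Z @^-1` B) (k (Z w))%:E =
                              \int[P]_(w in Z @^-1` B) (V w)%:E)%E) ->
  is_cond_exp P Z V (k \o Z).
Proof.
move=> mk iV ik kV; split => // [_ B mB|_ [B mB <-]]; last by rewrite setTI kV.
exists (k @^-1` B); last by rewrite !setTI.
by rewrite -[k @^-1` _]setTI; exact: mk.
Qed.

Lemma is_cond_expB V1 V2 W1 W2 : is_cond_exp P Z V1 W1 ->
  is_cond_exp P Z V2 W2 -> is_cond_exp P Z (V1 \- V2) (W1 \- W2).
Proof.
move=> [iV1 iW1 mW1 e1] [iV2 iW2 mW2 e2]; split.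
- exact: (integrableB measurableT iV1 iV2).
- exact: (integrableB measurableT iW1 iW2).
- exact: measurable_funB.
- move=> A sA; have mA := measurable_g_sigma_algebra_preimage sA.
  have iA V : P.-integrable setT (EFin \o V) -> P.-integrable A (EFin \o V).
    exact: integrableS.
  rewrite (integralB_EFin mA (iA _ iW1) (iA _ iW2)).
  by rewrite (integralB_EFin mA (iA _ iV1) (iA _ iV2)) e1// e2.
Qed.

Lemma is_cond_expZ (a : R) V W : is_cond_exp P Z V W ->
  is_cond_exp P Z (fun w => a * V w) (fun w => a * W w).
Proof.
move=> [iV iW mW e]; split.
- exact: (integrableZl measurableT a iV).
- exact: (integrableZl measurableT a iW).
- exact: measurable_funM.
- move=> A sA; have mA := measurable_g_sigma_algebra_preimage sA.
  have iA V' : P.-integrable setT (EFin \o V') -> P.-integrable A (EFin \o V').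
    exact: integrableS.
  by rewrite (integralZl mA (iA _ iW)) (integralZl mA (iA _ iV)) e.
Qed.

Lemma is_cond_exp_sum (I : Type) (s : seq I) (V W : I -> T -> R) :
  (forall i, is_cond_exp P Z (V i) (W i)) ->
  is_cond_exp P Z (fun w => \sum_(i <- s) V i w) (fun w => \sum_(i <- s) W i w).
Proof.
move=> VW.
have sumE (F : I -> T -> R) : EFin \o (fun w => \sum_(i <- s) F i w) =
    (fun w => \sum_(i <- s) (F i w)%:E)%E.
  by apply/funext => w /=; rewrite -sumEFin.
split.
- rewrite sumE; apply: integrable_sum => // i _; by case: (VW i).
- rewrite sumE; apply: integrable_sum => // i _; by case: (VW i).
- apply: measurable_sum => i; by case: (VW i).
- move=> A sA; have mA := measurable_g_sigma_algebra_preimage sA.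
  have := sumE V => /(congr1 (fun f => \int[P]_(w in A) f w)%E) /= ->.
  have := sumE W => /(congr1 (fun f => \int[P]_(w in A) f w)%E) /= ->.
  rewrite !integral_sum//; first by apply: eq_bigr => i _; case: (VW i) => _ _ _ ->.
  + by move=> i; case: (VW i) => iV _ _ _; exact: integrableS iV.
  + by move=> i; case: (VW i) => _ iW _ _; exact: integrableS iW.
Qed.

(** Conditional expectation is an L1 contraction: the events W >= 0 and W < 0
    belong to sigma(Z), so on each of them the integral of |W| is that of V up to
    sign. Uniqueness of versions and stability under L1 limits both follow. *)
Lemma is_cond_exp_le_L1 V W : is_cond_exp P Z V W ->
  (\int[P]_w `|(W w)%:E| <= \int[P]_w `|(V w)%:E|)%E.
Proof.
move=> [iV iW mW e].
pose D := [set w | 0 <= W w].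
have sD : g_sigma_algebra_preimage Z D.
  have := mW measurableT `[0, +oo[%classic (measurable_itv _).
  by rewrite setTI; congr (measurable _); apply/seteqP; split => w /=;
     rewrite in_itv/= andbT.
have sC : g_sigma_algebra_preimage Z (~` D) :=
  @measurableC _ (g_sigma_algebra_preimageType Z) D sD.
have mD := measurable_g_sigma_algebra_preimage sD.
have mC := measurable_g_sigma_algebra_preimage sC.
have iA F A : P.-integrable setT (EFin \o F) -> measurable A ->
    P.-integrable A (EFin \o F).
  by move=> iF mA; exact: integrableS iF.
have split_int F : P.-integrable setT (EFin \o F) -> (\int[P]_w `|(F w)%:E| =
    \int[P]_(w in D) `|(F w)%:E| + \int[P]_(w in ~` D) `|(F w)%:E|)%E.
  move=> iF; rewrite -ge0_integral_setU//= ?setUv//; last exact/disj_setPCl.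
  exact: measurable_funTS (measurable_int P (integrable_abse iF)).
rewrite !split_int//; apply: leeD.
- have -> : (\int[P]_(w in D) `|(W w)%:E| = \int[P]_(w in D) (W w)%:E)%E.
    by apply: eq_integral => w /set_mem Dw; rewrite gee0_abs.
  rewrite e//; apply: le_integral => //; first exact: iA.
    by apply: integrable_abse; exact: iA.
  by move=> w _; exact: lee_abs.
- have -> : (\int[P]_(w in ~` D) `|(W w)%:E| = \int[P]_(w in ~` D) - (W w)%:E)%E.
    apply: eq_integral => w /set_mem/negP; rewrite -ltNge => Dw.
    by rewrite lee0_abs// lee_fin ltW.
  have iN F : P.-integrable setT (EFin \o F) ->
     (\int[P]_(w in ~` D) - (F w)%:E = - \int[P]_(w in ~` D) (F w)%:E)%E.
    move=> iF; apply: (@integralN _ _ _ P _ (EFin \o F)).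
    exact: integrable_add_def (iA _ _ iF mC).
  rewrite iN// e// -iN//; apply: le_integral => //.
  + exact: integrableN (iA _ _ iV mC).
  + by apply: integrable_abse; exact: iA.
  + by move=> w _; rewrite -abseN; exact: lee_abs.
Qed.

(** The difference of two versions is a version of the conditional expectation
    of 0, so the L1 contraction makes its norm vanish. *)
Lemma is_cond_exp_unique V W1 W2 : is_cond_exp P Z V W1 ->
  is_cond_exp P Z V W2 -> \forall w \ae P, W1 w = W2 w.
Proof.
move=> h1 h2; have h := is_cond_expB h1 h2.
have := is_cond_exp_le_L1 h; rewrite [leRHS]integral0_eq; last first.
  by move=> w _ /=; rewrite subrr normr0.
move=> le0.
have/ae_eq_integral_abs : (\int[P]_(x in setT) `|((W1 \- W2) x)%:E| = 0)%E.
  by apply/eqP; rewrite eq_le le0 integral_ge0.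
move=> /(_ measurableT).
case: h => _ iW _ _ /(_ (measurable_int _ iW)) [N [mN N0 sub]].
exists N; split => // w /= neq; apply: sub => /= /(_ I) [].
by move/eqP; rewrite subr_eq0 => /eqP.
Qed.

(** The Radon-Nikodym theorem is applied on the target space of Z, to the image
    under Z of the charge with density V; this yields at once a version that is
    a measurable function of Z. *)
Lemma is_cond_exp_exists V : P.-integrable setT (EFin \o V) ->
  exists2 k : T' -> R, measurable_fun setT k & is_cond_exp P Z V (k \o Z).
Proof.
move=> iV.
pose Zm : {mfun T >-> T'} := HB.pack Z (isMeasurableFun.Build _ _ _ _ Z mZ).
pose nu_ : {charge set T' -> \bar R} := pushforward (induced_charge iV) Zm.
(* [nu_] still abstracts over the measurability of Z *)
pose nu := nu_ mZ.
have numu : nu `<< distribution P Zm.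
  apply/null_content_dominatesP => B mB B0.
  apply: null_set_integral => //; first exact: measurable_preimage.
  by apply: measurable_funTS; exact: measurable_int iV.
pose k0 := Radon_Nikodym nu (distribution P Zm).
have ik0 : (distribution P Zm).-integrable setT k0.
  exact: Radon_Nikodym_integrable.
have k0E x : (fine (k0 x))%:E = k0 x.
  by rewrite fineK// Radon_Nikodym_fin_num.
have mk0 : measurable_fun setT k0 := measurable_int _ ik0.
have mk : measurable_fun setT (fine \o k0) by exact: measurableT_comp.
have ik : P.-integrable setT (EFin \o ((fine \o k0) \o Z)).
  have -> : EFin \o ((fine \o k0) \o Z) = k0 \o Z.
    by apply/funext => x /=; rewrite k0E.
  apply/integrableP; split; first exact: measurableT_comp.
  move/integrableP : ik0 => [_]; rewrite ge0_integral_distribution//.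
  exact: measurableT_comp.
exists (fine \o k0) => //; apply: is_cond_exp_factor => // B mB.
under eq_integral do rewrite /= k0E.
rewrite -(integral_pushforward mZ mk0 _ mB); last first.
  apply: (integrableS measurableT) => //; first exact: measurable_preimage.
  by move: ik; congr (integrable _ _ _); apply/funext => x /=; rewrite k0E.
exact/esym/(Radon_Nikodym_integral numu mB).
Qed.

Lemma is_cond_exp_cond_exp V : P.-integrable setT (EFin \o V) ->
  is_cond_exp P Z V (cond_exp P Z V).
Proof.
move=> iV; have [k _ kV] := is_cond_exp_exists iV.
by apply: (@xgetPex _ (fun=> 0) [set W | is_cond_exp P Z V W]); exists (k \o Z).
Qed.

Lemma cond_exp_ae V W : is_cond_exp P Z V W ->
  \forall w \ae P, cond_exp P Z V w = W w.
Proof.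
move=> VW; have [iV _ _ _] := VW.
exact: (is_cond_exp_unique (is_cond_exp_cond_exp iV) VW).
Qed.

End conditional_expectation.

(** * Changing the probability space *)
Section transfer.
Context d1 d2 (T : measurableType d1) (S : measurableType d2) (R : realType).
Variables (P : probability T R) (Q : probability S R) (F : T -> S).
Hypotheses (mF : measurable_fun setT F) (PF : has_law P F Q).

Lemma ge0_integral_has_law (g : S -> \bar R) : measurable_fun setT g ->
  (forall s, 0 <= g s)%E -> (\int[P]_w g (F w) = \int[Q]_s g s)%E.
Proof.
move=> mg g0; transitivity (\int[pushforward P F]_s g s)%E.
  by rewrite ge0_integral_pushforward.
by apply: eq_measure_integral => A mA _; exact: PF.
Qed.

Lemma integrable_has_law (g : S -> \bar R) :
  Q.-integrable setT g -> P.-integrable setT (g \o F).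
Proof.
move=> /integrableP[mg ig]; apply/integrableP; split; first exact: measurableT_comp.
rewrite (ge0_integral_has_law (g := fun s => `|g s|%E))//.
exact: measurableT_comp.
Qed.

Lemma integral_has_law (g : S -> \bar R) (B : set S) : measurable B ->
  Q.-integrable setT g ->
  (\int[P]_(w in F @^-1` B) g (F w) = \int[Q]_(s in B) g s)%E.
Proof.
move=> mB ig; have mg := measurable_int _ ig.
transitivity (\int[pushforward P F]_(s in B) g s)%E.
  rewrite (integral_pushforward mF mg)//.
  apply: (integrableS measurableT) => //; last exact: integrable_has_law.
  exact: measurable_preimage.
by apply: eq_measure_integral => A mA _; exact: PF.
Qed.

(** Conditional expectations only depend on the joint law, so they can be
    computed on the path space and read on any space that carries the process. *)
Lemma is_cond_exp_has_law d3 (T' : measurableType d3) (Z : S -> T')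
    (V W : S -> R) : measurable_fun setT Z ->
  is_cond_exp Q Z V W -> is_cond_exp P (Z \o F) (V \o F) (W \o F).
Proof.
move=> mZ [iV iW mW e]; split.
- exact: integrable_has_law iV.
- exact: integrable_has_law iW.
- move=> _ B mB; have [C mC] := mW measurableT _ mB; rewrite !setTI => eC.
  by exists C; rewrite // setTI comp_preimage eC.
- move=> _ [B mB <-]; rewrite setTI comp_preimage.
  rewrite (integral_has_law _ iV) ?(integral_has_law _ iW);
    [|exact: measurable_preimage..].
  by apply: e; exists B => //; rewrite setTI.
Qed.

Lemma has_law_integrable (g : S -> \bar R) : measurable_fun setT g ->
  P.-integrable setT (g \o F) -> Q.-integrable setT g.
Proof.
move=> mg /integrableP[_ ig]; apply/integrableP; split => //.
rewrite -(@ge0_integral_has_law (fun s => `|g s|%E))//; exact: measurableT_comp.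
Qed.

(** An almost sure statement needs a measurable exceptional set; for vectors it
    is the event that the norm of the difference is not zero. *)
Lemma ae_eq_has_law n (u v : S -> vec R n) : measurable_fun setT u ->
  measurable_fun setT v -> (forall w, u (F w) = v (F w)) ->
  \forall s \ae Q, u s = v s.
Proof.
move=> mu mv uv.
have mN : measurable ((fun s => enorm (tsub (u s) (v s))) @^-1` [set~ 0]).
  apply: (measurable_preimage (measurable_enorm (measurable_tsub mu mv))).
  exact: measurableC (measurable_set1 0).
exists ((fun s => enorm (tsub (u s) (v s))) @^-1` [set~ 0]); split => //.
- rewrite -PF// (_ : F @^-1` _ = set0) ?measure0//.
  apply/seteqP; split => // w /=; apply.
  by apply/enorm_eq0P => i; rewrite tnth_tsub uv subrr.
- by move=> s /= neq /enorm_tsub_eq0.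
Qed.

End transfer.

(** * Bounded test functions of the conditioning variable *)

Section bounded_test_function.
Context d1 d2 (T : measurableType d1) (T' : measurableType d2) (R : realType).
Variables (P : probability T R) (Z : T -> T').
Hypothesis mZ : measurable_fun setT Z.
Variable D : T -> R.
Hypotheses (iD : P.-integrable setT (EFin \o D))
  (D0 : forall B, measurable B -> (\int[P]_(w in Z @^-1` B) (D w)%:E = 0)%E).
Import HBSimple HBNNSimple.

Let integrable_bnd (h : T' -> R) (M : R) : measurable_fun setT h ->
  (forall z, `|h z| <= M) ->
  P.-integrable setT (fun w => (h (Z w) * D w)%:E).
Proof.
move=> mh hM.
apply: (@integrableMr _ _ _ _ _ measurableT (h \o Z)) iD.
  exact: measurableT_comp.
exists M; split; first exact: num_real.
by move=> x Mx w _; exact: le_trans (hM _) (ltW Mx).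
Qed.

Let integral_sfun0 (g : {sfun T' >-> R}) : (\int[P]_w (g (Z w) * D w)%:E = 0)%E.
Proof.
have mS r : measurable (g @^-1` [set r]) by exact: measurable_sfunP.
transitivity (\int[P]_w (\sum_(r <- fset_set (range g))
   (r%:E * (\1_(g @^-1` [set r]) (Z w) * D w)%:E)))%E.
  apply: eq_integral => w _; rewrite fimfunE fsbig_finite//= mulr_suml -sumEFin.
  by apply: eq_bigr => r _; rewrite -EFinM mulrA.
have iS r : P.-integrable setT (fun w => (\1_(g @^-1` [set r]) (Z w) * D w)%:E).
  apply: (@integrable_bnd _ 1); first exact: measurable_indic.
  by move=> z; rewrite indicE; case: (_ \in _); rewrite ?normr1 ?normr0.
rewrite integral_sum//; last by move=> r; exact: integrableZl.
rewrite big1// => r _; rewrite integralZl//.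
rewrite [X in (_ * X)%E](_ : _ = 0%E) ?mule0// -[RHS](D0 (mS r)) [RHS]integral_mkcond.
apply: eq_integral => w _; rewrite patchE indicE.
have -> : (w \in Z @^-1` (g @^-1` [set r])) = (Z w \in g @^-1` [set r]).
  by apply/idP/idP => /set_mem h; exact/mem_set.
by case: ifPn; rewrite ?mul1r ?mul0r.
Qed.

Let integral_ge0_bnd0 (h : T' -> R) (M : R) : measurable_fun setT h ->
  (forall z, 0 <= h z <= M) -> (\int[P]_w (h (Z w) * D w)%:E = 0)%E.
Proof.
move=> mh hM.
have meh : measurable_fun setT (EFin \o h) by exact/measurable_EFinP.
have h0 z : (0 <= (EFin \o h) z)%E by rewrite lee_fin; case/andP: (hM z).
pose g_ := nnsfun_approx measurableT meh.
have g_cvg z : g_ ^~ z @ \oo --> h z.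
  have /fine_cvgP[_] : EFin \o g_ ^~ z @ \oo --> (EFin \o h) z.
    by apply: cvg_nnsfun_approx.
  exact.
have g_le n z : g_ n z <= h z.
  rewrite -(cvg_lim _ (g_cvg z))//; apply: nondecreasing_cvgn_le.
    by move=> m k mk; exact/lefP/nd_nnsfun_approx.
  by apply/cvg_ex; exists (h z).
have mDw : measurable_fun setT D by apply/measurable_EFinP; exact: measurable_int iD.
have mgD (g : T' -> R) : measurable_fun setT g ->
    measurable_fun setT (fun w => (g (Z w) * D w)%:E).
  by move=> mg; apply/measurable_EFinP/measurable_funM => //; exact: measurableT_comp.
have [] := @dominated_convergence _ _ _ P setT measurableT
  (fun n w => (g_ n (Z w) * D w)%:E) (fun w => (h (Z w) * D w)%:E)
  (fun w => (M%:E * `|(D w)%:E|)%E).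
- by move=> n; apply: mgD.
- exact: mgD.
- apply: aeW => w _; apply: cvg_EFin; first exact: nearW.
  by apply: cvgM; [exact: g_cvg|exact: cvg_cst].
- exact/integrableZl/integrable_abse.
- apply: aeW => w n _; rewrite -EFinM lee_fin normrM ler_wpM2r//.
  rewrite ger0_norm//; apply: le_trans (g_le n _) _.
  by case/andP: (hM (Z w)).
move=> _ _; rewrite (_ : [sequence _]_n = cst 0%E); last first.
  by apply/funext => n; exact: integral_sfun0.
by move/cvg_lim => <- //; rewrite lim_cst.
Qed.

(** If D integrates to zero on the events of sigma(Z), it is orthogonal to the
    bounded functions of Z: simple functions by linearity, nonnegative bounded
    ones by dominated convergence, and the general case after adding M. *)
Lemma integral_bounded_test0 (h : T' -> R) (M : R) : measurable_fun setT h ->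
  (forall z, `|h z| <= M) -> (\int[P]_w (h (Z w) * D w)%:E = 0)%E.
Proof.
move=> mh hM.
have -> : (fun w => (h (Z w) * D w)%:E) =
    (fun w => ((h (Z w) + M) * D w)%:E - (M * D w)%:E)%E.
  by apply/funext => w; rewrite -EFinB mulrDl addrK.
have M0 : 0 <= M by exact: le_trans (hM point).
have hM2 z : 0 <= h z + M <= M + M.
  by have := hM z; rewrite ler_norml lerD2r -lerBlDr sub0r.
rewrite integralB_EFin//.
- rewrite (@integral_ge0_bnd0 (fun z => h z + M) (M + M))//; last first.
    exact: measurable_funD.
  rewrite (@integral_ge0_bnd0 (cst M) M) ?sube0// => z.
  by rewrite M0 lexx.
- apply: (@integrable_bnd (fun z => h z + M) (M + M)) => [|z].
    exact: measurable_funD.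
  by rewrite ger0_norm; case/andP: (hM2 z).
- by apply: (@integrable_bnd (cst M) M) => // z; rewrite /= ger0_norm.
Qed.

End bounded_test_function.

(** * Equality of conditional laws *)
Section equal_conditional_laws.
Context d0 d1 d2 d3 (T : measurableType d0) (T1 : measurableType d1)
  (T2 : measurableType d2) (T3 : measurableType d3) (R : realType).
Variables (P : probability T R) (Y : T -> T3) (Z1 : T -> T1) (Z2 : T -> T2).
Hypotheses (mY : measurable_fun setT Y) (mZ1 : measurable_fun setT Z1)
  (mZ2 : measurable_fun setT Z2).
Import HBSimple.

Let integrable_indic_preimage (C : set T3) : measurable C ->
  P.-integrable setT (EFin \o \1_(Y @^-1` C)).
Proof. by move=> mC; apply: integrable_indic; exact: measurable_preimage. Qed.

Let eq_cond_law_indic (C : set T3) (B : set T1) :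
  eq_cond_law P Y Z1 Z2 -> measurable C -> measurable B ->
  (\int[P]_(w in Z1 @^-1` B) (cond_law P Z2 Y C w)%:E =
   \int[P]_(w in Z1 @^-1` B) (\1_(Y @^-1` C) w)%:E)%E.
Proof.
move=> eqL mC mB; have iC := integrable_indic_preimage mC.
have v1 := is_cond_exp_cond_exp mZ1 iC; have v2 := is_cond_exp_cond_exp mZ2 iC.
rewrite -(is_cond_exp_integral v1 mB); apply: ae_eq_integral.
- exact: measurable_preimage.
- by case: v2 => _ /measurable_int + _ _; exact: measurable_funTS.
- by case: v1 => _ /measurable_int + _ _; exact: measurable_funTS.
- by apply: filterS (eqL _ mC) => w /= e _; rewrite /cond_law in e; rewrite e.
Qed.

Let simple_version (g : {sfun T3 >-> R}) (w : T) : R :=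
  \sum_(r <- fset_set (range g)) r * cond_law P Z2 Y (g @^-1` [set r]) w.

Let sfunE (g : {sfun T3 >-> R}) : g \o Y = fun w =>
  \sum_(r <- fset_set (range g)) r * \1_(Y @^-1` (g @^-1` [set r])) w.
Proof. by apply/funext => w; rewrite /= fimfunE fsbig_finite. Qed.

Let is_cond_exp_simple (g : {sfun T3 >-> R}) :
  is_cond_exp P Z2 (g \o Y) (simple_version g).
Proof.
rewrite sfunE; apply: is_cond_exp_sum => // r; apply: is_cond_expZ => //.
by apply: is_cond_exp_cond_exp => //; exact: integrable_indic_preimage.
Qed.

Let eq_cond_law_simple (g : {sfun T3 >-> R}) (B : set T1) :
  eq_cond_law P Y Z1 Z2 -> measurable B ->
  (\int[P]_(w in Z1 @^-1` B) (simple_version g w)%:E =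
   \int[P]_(w in Z1 @^-1` B) (g (Y w))%:E)%E.
Proof.
move=> eqL mB.
have mA := measurable_preimage mZ1 mB.
have iA F : P.-integrable setT (EFin \o F) ->
    P.-integrable (Z1 @^-1` B) (EFin \o F) by exact: integrableS.
have int_sum (F : R -> T -> R) : (forall r, P.-integrable setT (EFin \o F r)) ->
    (\int[P]_(w in Z1 @^-1` B) (\sum_(r <- fset_set (range g)) r * F r w)%:E =
     \sum_(r <- fset_set (range g))
       r%:E * \int[P]_(w in Z1 @^-1` B) (F r w)%:E)%E.
  move=> iF; under eq_integral do rewrite -sumEFin.
  rewrite integral_sum//.
    by apply: eq_bigr => r _; under eq_integral do rewrite EFinM;
       rewrite integralZl//; exact: iA.
  by move=> r; exact: (integrableZl mA r (iA _ (iF r))).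
have -> : (fun w => (g (Y w))%:E) = (fun w => (\sum_(r <- fset_set (range g))
    r * \1_(Y @^-1` (g @^-1` [set r])) w)%:E).
  by have := sfunE g => /(congr1 (fun f w => (f w)%:E)).
rewrite !int_sum//.
- by apply: eq_bigr => r _; rewrite eq_cond_law_indic.
- move=> r; have iC := integrable_indic_preimage (measurable_sfunP g (measurable_set1 r)).
  by have [] := is_cond_exp_cond_exp mZ2 iC.
- by move=> r; exact: integrable_indic_preimage (measurable_sfunP g (measurable_set1 r)).
Qed.

(** Equality of conditional probabilities extends to conditional expectations:
    a version of E[f(Y) | Z2] also satisfies the averaging identity of
    E[f(Y) | Z1]. This holds for simple f by linearity; in general f is
    approximated in L1 of the law of Y, and the L1 contraction controls the
    error on both sides. *)
Lemma eq_cond_law_integral (f : T3 -> R) (W : T -> R) (B : set T1) :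
  eq_cond_law P Y Z1 Z2 -> measurable_fun setT f ->
  is_cond_exp P Z2 (f \o Y) W -> measurable B ->
  (\int[P]_(w in Z1 @^-1` B) (W w)%:E =
   \int[P]_(w in Z1 @^-1` B) (f (Y w))%:E)%E.
Proof.
move=> eqL mf fW mB; have [iV iW _ _] := fW.
have mA := measurable_preimage mZ1 mB.
have iA F : P.-integrable setT (EFin \o F) ->
    P.-integrable (Z1 @^-1` B) (EFin \o F) by exact: integrableS.
have mef : measurable_fun setT (EFin \o f) by exact/measurable_EFinP.
have ief : (pushforward P Y).-integrable setT (EFin \o f).
  exact: integrable_pushforward.
have [g [ig _ g_cvg]] := approximation_sfun_integrable measurableT ief.
pose e n := (\int[P]_w `|(f (Y w) - g n (Y w))%:E|)%E.
have e0 : e n @[n --> \oo] --> 0%E.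
  apply: cvg_trans g_cvg; apply: near_eq_cvg; apply: nearW => n.
  rewrite ge0_integral_pushforward//; apply: measurableT_comp => //.
  by apply: emeasurable_funB => //; exact/measurable_EFinP.
have diff_le F : P.-integrable setT (EFin \o F) ->
    (`|\int[P]_(w in Z1 @^-1` B) (F w)%:E| <= \int[P]_w `|(F w)%:E|)%E.
  move=> iF; apply: (le_trans (le_abse_integral _ mA _)).
    exact: measurable_int (iA _ iF).
  apply: ge0_subset_integral => //.
  exact: (measurable_int _ (integrable_abse iF)).
(* the simple parts cancel; what remains is an approximation error for W and
   one for f(Y), each at most e n *)
have bound n : (`|\int[P]_(w in Z1 @^-1` B) (W w)%:E -
    \int[P]_(w in Z1 @^-1` B) (f (Y w))%:E| <= e n + e n)%E.
  have gW := is_cond_exp_simple (g n); have [iVn iWn _ _] := gW.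
  have dW := is_cond_expB mZ2 fW gW; have [iVd iWd _ _] := dW.
  have -> : (\int[P]_(w in Z1 @^-1` B) (W w)%:E -
      \int[P]_(w in Z1 @^-1` B) (f (Y w))%:E =
      \int[P]_(w in Z1 @^-1` B) ((W \- simple_version (g n)) w)%:E -
      \int[P]_(w in Z1 @^-1` B) (((f \o Y) \- (g n \o Y)) w)%:E)%E.
    rewrite (integralB_EFin mA (iA _ iW) (iA _ iWn)).
    rewrite (integralB_EFin mA (iA _ iV) (iA _ iVn)) /=.
    rewrite eq_cond_law_simple//.
    have := integrable_fin_num mA (iA _ iVn).
    have := integrable_fin_num mA (iA _ iV).
    have := integrable_fin_num mA (iA _ iW).
    move=> /fineK <- /fineK <- /fineK <-.
    by rewrite -!EFinB opprB addrA subrK.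
  apply: (le_trans (lee_abs_sub _ _)); apply: leeD; last exact: diff_le.
  apply: le_trans (is_cond_exp_le_L1 mZ2 dW); exact: diff_le.
have : (`|\int[P]_(w in Z1 @^-1` B) (W w)%:E -
    \int[P]_(w in Z1 @^-1` B) (f (Y w))%:E| <= 0)%E.
  have e20 : (e n + e n)%E @[n --> \oo] --> (0 + 0)%E by exact: cvgeD.
  rewrite -[leRHS]adde0 -(cvg_lim _ e20)//; apply: lime_ge.
    by apply/cvg_ex; exists (0 + 0)%E.
  exact: nearW.
have := integrable_fin_num mA (iA _ iV); have := integrable_fin_num mA (iA _ iW).
move=> /fineK <- /fineK <-; rewrite -EFinB lee_fin normr_le0 subr_eq0.
by move=> /eqP ->.
Qed.

End equal_conditional_laws.

Section equivalent_conditioning.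
Context d0 d1 d2 d3 (T : measurableType d0) (T1 : measurableType d1)
  (T2 : measurableType d2) (T3 : measurableType d3) (R : realType).
Variables (P : probability T R) (Y : T -> T3) (Z1 : T -> T1) (Z2 : T -> T2).
Hypotheses (mY : measurable_fun setT Y) (mZ1 : measurable_fun setT Z1)
  (mZ2 : measurable_fun setT Z2).

(** Two variables that determine each other give the same conditional laws. The
    relation Z2 = p(Z1) makes a function of Z2 a function of Z1, hence
    sigma(Z1)-measurable; the relation Z1 = f(Z2) identifies, up to null sets, the
    events of sigma(Z1) with events of sigma(Z2). *)
Lemma eq_cond_law_ae_fun (p : T1 -> T2) (f : T2 -> T1) :
  measurable_fun setT p -> measurable_fun setT f ->
  (forall w, Z2 w = p (Z1 w)) -> (\forall w \ae P, Z1 w = f (Z2 w)) ->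
  eq_cond_law P Y Z1 Z2.
Proof.
move=> mp mf Z21 Z12 C mC.
have iC : P.-integrable setT (EFin \o \1_(Y @^-1` C)).
  by apply: integrable_indic; exact: measurable_preimage.
have [k mk kC] := is_cond_exp_exists mZ2 iC; have [_ ik _ _] := kC.
have kE : k \o Z2 = (k \o p) \o Z1 by apply/funext => w /=; rewrite Z21.
have swap F (B : set T1) : measurable B -> P.-integrable setT (EFin \o F) ->
    (\int[P]_(w in Z1 @^-1` B) (F w)%:E =
     \int[P]_(w in Z2 @^-1` (f @^-1` B)) (F w)%:E)%E.
  move=> mB iF; rewrite [LHS]integral_mkcond [RHS]integral_mkcond.
  have m1 := measurable_preimage mZ1 mB.
  have m2 := measurable_preimage mZ2 (measurable_preimage mf mB).
  apply: ae_eq_integral => //.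
  - apply/(measurable_restrictT _ m1).1/measurable_funTS; exact: measurable_int iF.
  - apply/(measurable_restrictT _ m2).1/measurable_funTS; exact: measurable_int iF.
  - apply: filterS Z12 => w /= e _; rewrite !patchE.
    suff -> : (w \in Z1 @^-1` B) = (w \in Z2 @^-1` (f @^-1` B)) by [].
    by apply/idP/idP => /set_mem h; apply/mem_set; move: h; rewrite /= -?e// e.
have k1 : is_cond_exp P Z1 (\1_(Y @^-1` C)) (k \o Z2).
  rewrite kE; apply: is_cond_exp_factor => //.
  - exact: measurableT_comp.
  - by rewrite -kE.
  - move=> B mB; have mfB := measurable_preimage mf mB.
    rewrite (swap _ _ mB iC) -(is_cond_exp_integral kC mfB) -swap//.
    by under eq_integral do rewrite /= -Z21.
apply: filterS2 (cond_exp_ae mZ1 k1) (cond_exp_ae mZ2 kC) => w.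
by rewrite /cond_law => -> ->.
Qed.

End equivalent_conditioning.

(** * The lower bound *)
Definition half_gap (R : realType) (d : nat) (m : 'I_d -> vec R d -> R)
    (x : vec R d) : vec R d :=
  [tuple (m i x - tnth x i) / 2 | i < d].

Lemma measurable_half_gap (R : realType) (d : nat) (m : 'I_d -> vec R d -> R) :
  (forall i, measurable_fun setT (m i)) -> measurable_fun setT (half_gap m).
Proof.
move=> mm; apply: measurable_mktuple => i.
apply: measurable_funM => //; apply: measurable_funB => //.
exact: measurable_tnth.
Qed.

Section coupling_projections.
Context (R : realType) (d : nat).
Notation path2 := (step_path R d * step_path R d)%type.

Lemma measurable_X : measurable_fun setT (fun w : path2 => w.1.1).
Proof. exact: measurableT_comp. Qed.
Lemma measurable_Y : measurable_fun setT (fun w : path2 => w.1.2).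
Proof. exact: measurableT_comp. Qed.
Lemma measurable_X' : measurable_fun setT (fun w : path2 => w.2.1).
Proof. exact: measurableT_comp. Qed.
Lemma measurable_Y' : measurable_fun setT (fun w : path2 => w.2.2).
Proof. exact: measurableT_comp. Qed.
Lemma measurable_XY : measurable_fun setT (fun w : path2 => (w.1.1, w.1.2)).
Proof. exact: measurable_fun_pair measurable_X measurable_Y. Qed.
Lemma measurable_X'Y' : measurable_fun setT (fun w : path2 => (w.2.1, w.2.2)).
Proof. exact: measurable_fun_pair measurable_X' measurable_Y'. Qed.
Lemma measurable_XX' : measurable_fun setT (fun w : path2 => (w.1.1, w.2.1)).
Proof. exact: measurable_fun_pair measurable_X measurable_X'. Qed.

Lemma measurable_aw_integrand (gamma : R) : measurable_fun setT
  (fun w : path2 => enorm (tsub w.1.2 w.2.2) `^ gamma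
             + enorm (tsub w.1.1 w.2.1) `^ gamma).
Proof.
apply: measurable_funD; apply: measurable_enorm_powR; apply: measurable_tsub.
- exact: measurable_Y.
- exact: measurable_Y'.
- exact: measurable_X.
- exact: measurable_X'.
Qed.

End coupling_projections.

Section lower_bound.
Context (R : realType) (d : nat) (gamma : R).
Hypothesis gamma1 : 1 <= gamma.
Variables (P Q : probability (step_path R d) R)
  (Pi : probability (step_path R d * step_path R d)%type R)
  (m : 'I_d -> vec R d -> R).
Hypotheses (mm : forall i, measurable_fun setT (m i))
  (mP : forall i, is_cond_exp P fst (fun w => tnth w.2 i) (m i \o fst))
  (Pi_bicausal : bicausal P Q Pi) (Q_martingale : martingale_law Q).

(** The remainder (Y - m(X)) - (Y' - X') paired with the gradient in the sum of
    the two tangent inequalities. *)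
Let noise (i : 'I_d) (w : step_path R d * step_path R d) : R :=
  (tnth w.1.2 i - m i w.1.1) - (tnth w.2.2 i - tnth w.2.1 i).

Let cond_exp_Y i : is_cond_exp Pi (fun w => w.1.1)
  (fun w => tnth w.1.2 i) (fun w => m i w.1.1).
Proof.
have [PiP _ _ _] := Pi_bicausal.
have mXY := @measurable_XY R d.
exact: (is_cond_exp_has_law mXY PiP measurable_fst (mP i)).
Qed.

Let cond_exp_Y' i : is_cond_exp Pi (fun w => w.2.1)
  (fun w => tnth w.2.2 i) (fun w => tnth w.2.1 i).
Proof.
have [_ PiQ _ _] := Pi_bicausal.
have mXY := @measurable_X'Y' R d.
exact: (is_cond_exp_has_law mXY PiQ measurable_fst (Q_martingale i)).
Qed.

Let noise_int i : [/\ Pi.-integrable setT (fun w => (tnth w.1.2 i - m i w.1.1)%:E),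
  Pi.-integrable setT (fun w => (tnth w.2.2 i - tnth w.2.1 i)%:E)
  & Pi.-integrable setT (EFin \o noise i)].
Proof.
have [iY im _ _] := cond_exp_Y i; have [iY' iX' _ _] := cond_exp_Y' i.
have i1 : Pi.-integrable setT (fun w => (tnth w.1.2 i - m i w.1.1)%:E).
  exact: (integrableB measurableT iY im).
have i2 : Pi.-integrable setT (fun w => (tnth w.2.2 i - tnth w.2.1 i)%:E).
  exact: (integrableB measurableT iY' iX').
by split => //; exact: (integrableB measurableT i1 i2).
Qed.

(** The first half vanishes by definition of m. For the second, causality lets
    the event on X be added to the conditioning on X' without changing
    E[Y' | X']. *)
Let integral_noise i (B : set (vec R d)) : measurable B ->
  (\int[Pi]_(w in (fun w => w.1.1) @^-1` B) (noise i w)%:E = 0)%E.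
Proof.
move=> mB; have [iY im _ _] := cond_exp_Y i.
have [iY' iX' _ _] := cond_exp_Y' i.
have [i1 i2 _] := noise_int i.
have mA := measurable_preimage (@measurable_X R d) mB.
set A := _ @^-1` B in mA *.
have iA F : Pi.-integrable setT (EFin \o F) -> Pi.-integrable A (EFin \o F).
  exact: integrableS.
rewrite /noise (integralB_EFin mA (iA _ i1) (iA _ i2)).
rewrite (integralB_EFin mA (iA _ iY) (iA _ im)).
rewrite (integralB_EFin mA (iA _ iY') (iA _ iX')).
rewrite (is_cond_exp_integral (cond_exp_Y i) mB).
have AE : A =
    (fun w : step_path R d * step_path R d => (w.1.1, w.2.1)) @^-1` (B `*` setT).
  by apply/seteqP; split => w //= -[].
have [_ _ _ causal'] := Pi_bicausal.
have := eq_cond_law_integral (@measurable_Y' R d) (@measurable_XX' R d)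
  (@measurable_X' R d) causal' (measurable_tnth i) (cond_exp_Y' i)
  (measurableX mB measurableT).
rewrite -AE => ->.
have /fineK <- := integrable_fin_num mA (iA _ iY).
have /fineK <- := integrable_fin_num mA (iA _ iY').
by rewrite -!EFinB !subrr.
Qed.

Let gap (x : vec R d) : R := enorm (half_gap m x) `^ gamma.
Let grad i (x : vec R d) : R := powgrad gamma (half_gap m x) i.
Let size_bound (x : vec R d) : R := gap x + \sum_(i < d) `|grad i x|.
(** Both the main term and the gradients are bounded on these sets: the former
    so that it is integrable, the latter so that they are admissible test
    functions. *)
Let trunc (n : nat) : set (vec R d) := [set x | size_bound x <= n%:R].

Let measurable_gap : measurable_fun setT gap.
Proof. by apply: measurable_enorm_powR; exact: measurable_half_gap. Qed.

Let measurable_grad i : measurable_fun setT (grad i).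
Proof.
have mc := measurable_half_gap mm.
apply: measurable_funM; last exact: measurable_tnth_comp.
by apply: measurable_funM => //; exact: measurable_enorm_powR.
Qed.

Let measurable_trunc n : measurable (trunc n).
Proof.
rewrite -[trunc n]setTI (_ : trunc n = size_bound @^-1` `]-oo, n%:R]%classic).
  have ms : measurable_fun setT size_bound.
    apply: measurable_funD => //; apply: measurable_sum => i.
    exact: measurableT_comp.
  exact: ms.
by apply/seteqP; split => x; rewrite /trunc/= in_itv.
Qed.

Let gap_ge0 x : 0 <= gap x. Proof. exact: powR_ge0. Qed.

Let trunc_gap n x : trunc n x -> gap x <= n%:R.
Proof.
by apply: le_trans; rewrite /size_bound lerDl sumr_ge0.
Qed.

Let trunc_grad n i x : trunc n x -> `|grad i x| <= n%:R.
Proof.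
apply: le_trans; rewrite /size_bound (bigD1 i)//= addrCA lerDl.
by rewrite addr_ge0// sumr_ge0.
Qed.

Let pointwise w : 2 * gap w.1.1 + \sum_(i < d) grad i w.1.1 * noise i w <=
  enorm (tsub w.1.2 w.2.2) `^ gamma + enorm (tsub w.1.1 w.2.1) `^ gamma.
Proof.
set c := half_gap m w.1.1.
have tY := enorm_powR_tangent gamma1 c (tsub w.1.2 w.2.2).
have tX := enorm_powR_tangent gamma1 c (tsub w.2.1 w.1.1).
have -> : enorm (tsub w.1.1 w.2.1) = enorm (tsub w.2.1 w.1.1).
  by apply: eq_enorm => i; rewrite !tnth_tsub; ring.
apply: le_trans (lerD tY tX); rewrite /gap -/c addrACA -big_split/=.
rewrite mulr_natl mulr2n lerD2l le_eqVlt; apply/orP; left; apply/eqP.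
apply: eq_bigr => i _; rewrite !tnth_tsub tnth_mktuple /noise -/(grad i _).
by field.
Qed.

(** The pointwise inequality holds with the left side set to zero off the
    truncation set, since the cost is nonnegative; integrating it removes the
    noise. *)
Let truncated_bound n : (\int[Pi]_(w in (fun w => w.1.1) @^-1` trunc n)
  (2 * gap w.1.1)%:E <= aw_cost gamma Pi)%E.
Proof.
have mc := @measurable_aw_integrand R d gamma.
have [->|] := eqVneq (aw_cost gamma Pi) +oo%E; first exact: leey.
rewrite -ltey => cost_fin.
have icost : Pi.-integrable setT (EFin \o (fun w => enorm (tsub w.1.2 w.2.2) `^ gamma
             + enorm (tsub w.1.1 w.2.1) `^ gamma)).
  apply/integrableP; split; first exact/measurable_EFinP.
  under eq_integral do rewrite /= ger0_norm ?addr_ge0 ?powR_ge0//.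
  exact: cost_fin.
have mtr : measurable_fun setT (\1_(trunc n) : vec R d -> R) by exact: measurable_indic.
pose h i x := grad i x * \1_(trunc n) x.
have mh i : measurable_fun setT (h i) by exact: measurable_funM.
have hn i x : `|h i x| <= n%:R.
  rewrite /h indicE; case: (boolP (x \in trunc n)) => [/set_mem xn|_].
    by rewrite mulr1; exact: trunc_grad.
  by rewrite mulr0 normr0.
pose G x := 2 * gap x * \1_(trunc n) x.
have mG : measurable_fun setT G.
  by apply: measurable_funM => //; exact: measurable_funM.
have Gn x : `|G x| <= 2 * n%:R.
  rewrite /G indicE; case: (boolP (x \in trunc n)) => [/set_mem xn|_].
    rewrite mulr1 ger0_norm ?mulr_ge0// ler_pM2l//; exact: trunc_gap.
  by rewrite mulr0 normr0 mulr_ge0.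
have iG : Pi.-integrable setT (fun w => (G w.1.1)%:E).
  apply: measurable_bounded_integrable => //.
  - exact: le_lt_trans (probability_le1 Pi measurableT) (ltry 1).
  - exact: measurableT_comp mG (@measurable_X R d).
  - exists (2 * n%:R); split; first exact: num_real.
    by move=> r nr w _; exact: le_trans (Gn _) (ltW nr).
have ih i : Pi.-integrable setT (fun w => (h i w.1.1 * noise i w)%:E).
  have [_ _ inoise] := noise_int i.
  apply: (@integrableMr _ _ _ _ _ measurableT (h i \o (fun w => w.1.1))) inoise.
    exact: measurableT_comp (mh i) (@measurable_X R d).
  exists n%:R; split; first exact: num_real.
  by move=> r nr w _; exact: le_trans (hn _ _) (ltW nr).
have ihs : Pi.-integrable setT (fun w => \sum_(i < d) (h i w.1.1 * noise i w)%:E)%E.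
  exact: integrable_sum.
have -> : (\int[Pi]_(w in (fun w => w.1.1) @^-1` trunc n) (2 * gap w.1.1)%:E =
    \int[Pi]_w (G w.1.1)%:E)%E.
  rewrite integral_mkcond; apply: eq_integral => w _; rewrite patchE /G indicE.
  have -> : (w \in (fun w => w.1.1) @^-1` trunc n) = (w.1.1 \in trunc n).
    by apply/idP/idP => /set_mem hw; exact/mem_set.
  by case: ifPn; rewrite ?mulr1 ?mulr0.
rewrite -[leLHS]adde0.
have <- : (\int[Pi]_w \sum_(i < d) (h i w.1.1 * noise i w)%:E = 0)%E.
  rewrite integral_sum// big1// => i _; have [_ _ inoise] := noise_int i.
  exact: (integral_bounded_test0 (@measurable_X R d) inoise
    (@integral_noise i) (mh i) (hn i)).
rewrite -integralD//; apply: le_integral => //; first exact: integrableD.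
move=> w _; rewrite sumEFin -EFinD lee_fin /G /h indicE.
case: (boolP (w.1.1 \in trunc n)) => _.
  rewrite mulr1; under eq_bigr do rewrite mulr1; exact: pointwise.
rewrite mulr0 add0r big1 ?addr_ge0 ?powR_ge0// => i _.
by rewrite mulr0 mul0r.
Qed.

(** The truncated bounds pass to the limit by monotone convergence, because the
    truncation sets exhaust the space. *)
Lemma half_gap_le_aw_cost :
  (\int[P]_w (2 * enorm (half_gap m w.1) `^ gamma)%:E <= aw_cost gamma Pi)%E.
Proof.
have [PiP _ _ _] := Pi_bicausal.
have mXY := @measurable_XY R d.
have mg : measurable_fun setT (fun x => (2 * gap x)%:E).
  by apply/measurable_EFinP; exact: measurable_funM.
rewrite -(ge0_integral_has_law mXY PiP (g := fun w => (2 * gap w.1)%:E)); first last.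
- by move=> w; rewrite lee_fin mulr_ge0.
- exact: measurableT_comp mg measurable_fst.
pose F n := (fun w : step_path R d * step_path R d => w.1.1) @^-1` trunc n.
have FT : \bigcup_n F n = setT.
  apply/seteqP; split => // w _; exists (Num.bound (size_bound w.1.1)) => //.
  rewrite /F/= /trunc/=; apply: ltW; apply: le_lt_trans (archi_boundP _).
    by [].
  by rewrite addr_ge0// sumr_ge0.
rewrite -FT.
have cvgF : (\int[Pi]_(w in F n) (2 * gap w.1.1)%:E)%E @[n --> \oo] -->
    (\int[Pi]_(w in \bigcup_n F n) (2 * gap w.1.1)%:E)%E.
  apply: ge0_nondecreasing_set_cvg_integral.
  - move=> k n kn; apply/subsetPset => w; rewrite /F/= /trunc/= => /le_trans; apply.
    by rewrite ler_nat.
  - by move=> n; exact: (measurable_preimage (@measurable_X R d) (measurable_trunc n)).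
  - move=> n; apply: measurable_funTS.
    exact: measurableT_comp mg (@measurable_X R d).
  - by move=> n w _; rewrite lee_fin mulr_ge0.
rewrite -(cvg_lim _ cvgF)//; apply: lime_le; first exact: cvgP cvgF.
by apply: nearW => n; exact: truncated_bound.
Qed.

End lower_bound.

(** * The upper bound *)
Section rounding.
Context (R : realType).

(** Only an injection of R into ]0, 1[ with a measurable inverse matters here;
    this one is monotone and its inverse is a logarithm. *)
Definition sigm (r : R) : R := (1 + expR r)^-1.

Definition frac (z : R) : R := z - (Num.floor z)%:~R.

(** The inverse of [sigm], applied to the fractional part. The reciprocal is
    written as a power because of the measurability of powers. *)
Definition logit (z : R) : R := ln (frac z `^ (-1) - 1).

Lemma sigm_gt0_lt1 r : 0 < sigm r < 1.
Proof.
have e0 := expR_gt0 r; rewrite /sigm invr_gt0 invf_lt1 ?addr_gt0//=.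
by rewrite ltrDl.
Qed.

Lemma logitK (k : int) (r : R) : logit (k%:~R + sigm r) = r.
Proof.
have /andP[s0 s1] := sigm_gt0_lt1 r.
rewrite /logit /frac (@floor_def _ _ k); last first.
  by rewrite lerDl ltW//= intrD ltrD2l.
rewrite (_ : k%:~R + sigm r - k%:~R = sigm r); last by rewrite addrC addKr.
by rewrite powR_inv1 ?ltW// /sigm invrK [1 + _]addrC addrK expRK.
Qed.

Lemma floor_sigm_near (z r : R) : `|(Num.floor z)%:~R + sigm r - z| <= 1.
Proof.
have /andP[s0 s1] := sigm_gt0_lt1 r; have := floor_itv z; rewrite intrD.
move=> /andP[z1 z2]; rewrite ler_norml; apply/andP; split; lra.
Qed.

Lemma measurable_floor : measurable_fun setT (fun z : R => (Num.floor z)%:~R : R).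
Proof.
apply: nondecreasing_measurable => // x y xy.
by rewrite ler_int; exact: le_floor.
Qed.

Lemma measurable_sigm : measurable_fun setT sigm.
Proof.
apply: nonincreasing_measurable => // x y xy.
have ex := expR_gt0 x; have ey := expR_gt0 y.
by rewrite /sigm lef_pV2 ?posrE ?addr_gt0// lerD2l ler_expR.
Qed.

Lemma measurable_logit : measurable_fun setT logit.
Proof.
apply: (measurableT_comp (@measurable_ln R)); apply: measurable_funB => //.
apply: (measurableT_comp (measurable_powR (-1))); apply: measurable_funB => //.
exact: measurable_floor.
Qed.

End rounding.

Section upper_bound.
Context (R : realType) (d : nat) (gamma : R).
Hypothesis gamma1 : 1 <= gamma.
Variables (P : probability (step_path R d) R) (m : 'I_d -> vec R d -> R) (s : R).
Hypotheses (mm : forall i, measurable_fun setT (m i))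
  (mP : forall i, is_cond_exp P fst (fun w => tnth w.2 i) (m i \o fst))
  (X_int : forall i, P.-integrable setT (fun w => (tnth w.1 i)%:E))
  (s0 : 0 < s).

Let eps : R := s / gamma / d%:R.

Let eps_gt0 (i : 'I_d) : 0 < eps.
Proof.
rewrite /eps !divr_gt0 ?(lt_le_trans _ gamma1)// ltr0n.
by apply: leq_ltn_trans (ltn_ord i).
Qed.

(** The midpoint of x and m(x), rounded down to a multiple of eps, with x stored
    inside the grid cell. *)
Let code i (x : vec R d) : R :=
  eps * ((Num.floor ((tnth x i + m i x) / 2 / eps))%:~R + sigm (tnth x i)).

Let X' (x : vec R d) : vec R d := [tuple code i x | i < d].

Let decode (x' : vec R d) : vec R d := [tuple logit (tnth x' i / eps) | i < d].

Let decodeK x : decode (X' x) = x.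
Proof.
apply: eq_from_tnth => i; rewrite !tnth_mktuple /code mulrC mulKf ?logitK//.
by rewrite gt_eqF// eps_gt0.
Qed.

Let code_near i x : `|code i x - (tnth x i + m i x) / 2| <= eps.
Proof.
have e0 := eps_gt0 i; set z := (tnth x i + m i x) / 2.
have -> : code i x - z = eps * ((Num.floor (z / eps))%:~R + sigm (tnth x i) - z / eps).
  by rewrite /code -/z mulrBr mulrCA divff ?mulr1// gt_eqF.
by rewrite normrM gtr0_norm// ger_pMr// floor_sigm_near.
Qed.

Let mcode i : measurable_fun setT (code i).
Proof.
have mt : measurable_fun setT (fun x : vec R d => tnth x i) by exact: measurable_tnth.
apply: measurable_funM => //; apply: measurable_funD.
  apply: (measurableT_comp (@measurable_floor R)).
  by apply: measurable_funM => //; apply: measurable_funM => //; exact: measurable_funD.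
exact: measurableT_comp (@measurable_sigm R) mt.
Qed.

Let mX' : measurable_fun setT X'.
Proof. exact: measurable_mktuple. Qed.

Let mdecode : measurable_fun setT decode.
Proof.
apply: measurable_mktuple => i; apply: (measurableT_comp (@measurable_logit R)).
by apply: measurable_funM => //; exact: measurable_tnth.
Qed.

(** The shift that turns the conditional mean of Y given X from m(X) into X'. *)
Let Y' (w : step_path R d) : vec R d :=
  [tuple (tnth w.2 i - m i w.1) + code i w.1 | i < d].

Let mY' : measurable_fun setT Y'.
Proof.
apply: measurable_mktuple => i; apply: measurable_funD; last exact: measurableT_comp.
apply: measurable_funB; last exact: measurableT_comp.
exact: measurableT_comp (measurable_tnth i) measurable_snd.
Qed.

Let Phi (w : step_path R d) := (w, (X' w.1, Y' w)).

Let Psi (w : step_path R d) := (X' w.1, Y' w).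

Let mPsi : measurable_fun setT Psi.
Proof.
by apply: measurable_fun_pair => //; exact: measurableT_comp mX' measurable_fst.
Qed.

Let mPhi : measurable_fun setT Phi.
Proof. by apply: measurable_fun_pair => //; exact: mPsi. Qed.

Let Psi_mfun : {mfun step_path R d >-> step_path R d} :=
  HB.pack Psi (isMeasurableFun.Build _ _ _ _ Psi mPsi).
Let Phi_mfun : {mfun step_path R d >-> (step_path R d * step_path R d)%type} :=
  HB.pack Phi (isMeasurableFun.Build _ _ _ _ Phi mPhi).

Let Q : probability (step_path R d) R := distribution P Psi_mfun.
Let Pi : probability (step_path R d * step_path R d)%type R :=
  distribution P Phi_mfun.

Let Psi_law : has_law P Psi Q. Proof. by []. Qed.
Let Phi_law : has_law P Phi Pi. Proof. by []. Qed.

Let integrable_code i : P.-integrable setT (fun w => (code i w.1)%:E).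
Proof.
have [_ im _ _] := mP i.
have e0 := eps_gt0 i.
have idom : P.-integrable setT
    (fun w => `|(tnth w.1 i)%:E| + (`|(m i w.1)%:E| + eps%:E))%E.
  apply: integrableD => //; first exact: integrable_abse.
  apply: integrableD => //; first exact: integrable_abse.
  exact: finite_measure_integrable_cst.
apply: le_integrable idom => //.
  by apply/measurable_EFinP; exact: measurableT_comp.
move=> w _; rewrite /= lee_fin.
rewrite [leRHS]ger0_norm; last by rewrite !addr_ge0// ltW.
have := code_near i w.1.
set x := tnth w.1 i; set y := m i w.1; set z := code i w.1 => h.
have : `|z| <= `|z - (x + y) / 2| + `|(x + y) / 2|.
  by apply: le_trans (ler_normD _ _); rewrite subrK.
have : `|(x + y) / 2| <= (`|x| + `|y|) / 2.
  by rewrite normrM [X in _ * X]ger0_norm// ler_pM2r// ler_normD.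
have := normr_ge0 x; have := normr_ge0 y; lra.
Qed.

(** Given X, the mean of Y' is X', and the events on X' are events on X. *)
Let Q_martingale : martingale_law Q.
Proof.
move=> i; have [iY im _ _] := mP i; have ic := integrable_code i.
have mx : measurable_fun setT (fun w : step_path R d => tnth w.1 i).
  exact: measurableT_comp (measurable_tnth i) measurable_fst.
have my : measurable_fun setT (fun w : step_path R d => tnth w.2 i).
  exact: measurableT_comp (measurable_tnth i) measurable_snd.
have xE : (fun w => (tnth w.1 i)%:E) \o Psi = fun w => (code i w.1)%:E.
  by apply/funext => w /=; rewrite tnth_mktuple.
have yE : (fun w => (tnth w.2 i)%:E) \o Psi =
    fun w => (((tnth w.2 i - m i w.1) + code i w.1)%:E).
  by apply/funext => w /=; rewrite tnth_mktuple.
have id : P.-integrable setT (fun w => (tnth w.2 i - m i w.1)%:E).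
  exact: (integrableB measurableT iY im).
have ix : Q.-integrable setT (fun w => (tnth w.1 i)%:E).
  apply: (has_law_integrable mPsi Psi_law); last by rewrite xE.
  exact/measurable_EFinP.
have iy : Q.-integrable setT (fun w => (tnth w.2 i)%:E).
  apply: (has_law_integrable mPsi Psi_law); last first.
    by rewrite yE; exact: (integrableD measurableT id ic).
  exact/measurable_EFinP.
apply: (@is_cond_exp_factor _ _ _ _ _ Q fst _ (fun x => tnth x i)) => //.
- exact: measurable_tnth.
- move=> B mB; have mfB : measurable (fst @^-1` B : set (step_path R d)).
    exact: (measurable_preimage measurable_fst mB).
  rewrite -(integral_has_law mPsi Psi_law mfB ix).
  rewrite -(integral_has_law mPsi Psi_law mfB iy).
  have -> : Psi @^-1` (fst @^-1` B) = fst @^-1` (X' @^-1` B) by [].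
  have mX'B := measurable_preimage mX' mB.
  have mA : measurable (fst @^-1` (X' @^-1` B) : set (step_path R d)).
    exact: (measurable_preimage measurable_fst mX'B).
  set A := fst @^-1` _ in mA *.
  have iA (F : step_path R d -> R) : P.-integrable setT (EFin \o F) ->
      P.-integrable A (EFin \o F) by exact: integrableS.
  under eq_integral do rewrite /= tnth_mktuple.
  under [RHS]eq_integral do rewrite /= tnth_mktuple EFinD.
  rewrite (integralD mA (iA _ id) (iA _ ic)) (integralB_EFin mA (iA _ iY) (iA _ im)).
  rewrite (is_cond_exp_integral (mP i) mX'B).
  by have /fineK <- := integrable_fin_num mA (iA _ iY); rewrite -EFinB subrr add0e.
Qed.

(** X' is a function of X, and X is the decoding of X', so conditioning on X, on
    X' or on both is the same. *)
Let Pi_bicausal : bicausal P Q Pi.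
Proof.
split.
- move=> A mA; rewrite /Pi /distribution /pushforward /=.
  by congr (P _); apply/seteqP; split => -[x y].
- by move=> A mA.
- apply: (eq_cond_law_ae_fun (@measurable_Y R d) (@measurable_XX' R d)
    (@measurable_X R d) (p := fst) (f := fun x => (x, X' x))) => //.
  + by apply: measurable_fun_pair.
  + have : \forall w \ae Pi, w.2.1 = X' w.1.1.
      apply: (ae_eq_has_law Phi_law (u := fun w => w.2.1)
        (v := fun w => X' w.1.1)) => //.
        exact: measurable_X'.
      exact: measurableT_comp mX' (@measurable_X R d).
    by apply: filterS => w <-.
- apply: (eq_cond_law_ae_fun (@measurable_Y' R d) (@measurable_XX' R d)
    (@measurable_X' R d) (p := snd) (f := fun x' => (decode x', x'))) => //.
  + by apply: measurable_fun_pair.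
  + have : \forall w \ae Pi, w.1.1 = decode w.2.1.
      apply: (ae_eq_has_law Phi_law (u := fun w => w.1.1)
        (v := fun w => decode w.2.1)) => [| |w /=].
      * exact: measurable_X.
      * exact: measurableT_comp mdecode (@measurable_X' R d).
      * by rewrite decodeK.
    by apply: filterS => w <-.
Qed.

(** Up to eps in each coordinate, Y - Y' and X' - X are both equal to the half
    gap. *)
Let cost_le w : (1 - s) * (enorm (tsub w.2 (Y' w)) `^ gamma
    + enorm (tsub w.1 (X' w.1)) `^ gamma) <=
  2 * enorm (half_gap m w.1) `^ gamma + 2 * s.
Proof.
have sg0 : 0 <= s / gamma.
  by rewrite ltW// divr_gt0// (lt_le_trans _ gamma1).
have h1 := @enorm_powR_perturb _ _ gamma1 _ (tsub w.2 (Y' w)) (half_gap m w.1) s.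
have h2 := @enorm_powR_perturb _ _ gamma1 _ (tsub (X' w.1) w.1) (half_gap m w.1) s.
have -> : enorm (tsub w.1 (X' w.1)) = enorm (tsub (X' w.1) w.1).
  by apply: eq_enorm => i; rewrite !tnth_tsub; ring.
rewrite mulrDr; apply: le_trans (lerD (h1 _) (h2 _)) _; last first.
- by move: {h1 h2} (enorm _ `^ _) => a; lra.
- apply: enorm_le_bound => // i; rewrite !tnth_tsub !tnth_mktuple.
  apply: le_trans (code_near i w.1); rewrite le_eqVlt.
  by apply/orP; left; apply/eqP; congr (`| _ |); field.
- apply: enorm_le_bound => // i; rewrite !tnth_tsub !tnth_mktuple.
  apply: le_trans (code_near i w.1); rewrite -[leRHS]normrN le_eqVlt.
  by apply/orP; left; apply/eqP; congr (`| _ |); field.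
Qed.

Lemma mpd_le : s < 1 -> ((1 - s)%:E * mpd P gamma <=
  \int[P]_w (2 * enorm (half_gap m w.1) `^ gamma)%:E + (2 * s)%:E)%E.
Proof.
move=> s1; have s10 : 0 <= 1 - s by rewrite subr_ge0 ltW.
apply: (@le_trans _ _ ((1 - s)%:E * aw_cost gamma Pi)%E).
  apply: lee_wpmul2l; first by rewrite lee_fin.
  apply: (@le_trans _ _ (aw_pow gamma P Q)); apply: ereal_inf_lbound.
    by exists Q.
  by exists Pi.
have mg : measurable_fun setT (fun w : step_path R d =>
    (2 * enorm (half_gap m w.1) `^ gamma)%:E).
  apply/measurable_EFinP; apply: measurable_funM => //.
  apply: measurable_enorm_powR.
  exact: measurableT_comp (measurable_half_gap mm) measurable_fst.
have mc := @measurable_aw_integrand R d gamma.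
rewrite /aw_cost -(ge0_integral_has_law mPhi Phi_law); first last.
- by move=> w; rewrite lee_fin addr_ge0// powR_ge0.
- exact/measurable_EFinP.
rewrite -(ge0_integralZl P measurableT); first last.
- by rewrite lee_fin.
- by move=> w _; rewrite lee_fin addr_ge0// powR_ge0.
- apply/measurable_EFinP; exact: measurableT_comp mc mPhi.
have -> : ((2 * s)%:E = \int[P]_w (2 * s)%:E)%E.
  by rewrite integral_cst// [X in (_ * X)%E]probability_setT mule1.
rewrite -ge0_integralD//; first last.
- by move=> w _; rewrite lee_fin mulr_ge0// ltW.
- by move=> w _; rewrite lee_fin mulr_ge0// powR_ge0.
apply: ge0_le_integral => //.
- by move=> w _; rewrite -EFinM lee_fin mulr_ge0// addr_ge0// powR_ge0.
- apply: measurable_funeM; apply/measurable_EFinP.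
  exact: measurableT_comp mc mPhi.
- exact: emeasurable_funD.
- by move=> w _; rewrite -EFinM -EFinD lee_fin; exact: cost_le.
Qed.

End upper_bound.

(** * The value of the martingale projection distance *)
(** The limit s -> 0, made explicit: if M > J, the slack s = (M - J) / (2 (M + 2))
    contradicts the hypothesis. *)
Lemma le_of_vanishing_slack (R : realType) (M J : \bar R) : (0 <= J)%E ->
  (forall s : R, 0 < s -> s < 1 -> ((1 - s)%:E * M <= J + (2 * s)%:E)%E) ->
  (M <= J)%E.
Proof.
case: J => [j j0 h|_ _|//]; last exact: leey.
have half0 : 0 < 2^-1 :> R by rewrite invr_gt0.
have half1 : 2^-1 < 1 :> R by rewrite invf_lt1// ltr1n.
case: M h => [r h|h|_]; last exact: leNye.
- rewrite lee_fin in j0; rewrite lee_fin leNgt; apply/negP => jr.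
  have r2 : 0 < 2 * (r + 2) by lra.
  pose s := (r - j) / (2 * (r + 2)).
  have sE : s * (2 * (r + 2)) = r - j by rewrite /s divfK ?gt_eqF.
  have s0 : 0 < s by rewrite divr_gt0// subr_gt0.
  have s1 : s < 1 by rewrite ltr_pdivrMr// mul1r; lra.
  by have := h s s0 s1; rewrite -EFinM -EFinD lee_fin; lra.
- have := h _ half0 half1; rewrite gt0_muley; last by rewrite lte_fin subr_gt0.
  by rewrite -EFinD leye_eq.
Qed.

Theorem theorem1 (R : realType) (d : nat) (hd : (1 <= d)%N)
    (gamma : R) (hgamma : 1 <= gamma)
    (P : probability (step_path R d) R)
    (disp : measure_display) (Omega : measurableType disp)
    (mu : probability Omega R)
    (X Y : {mfun Omega >-> vec R d})
    (hXY : has_law mu (fun w => (X w, Y w)) P)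
    (hfin : (\int[mu]_w (enorm (cat_tuple (X w) (Y w)) `^ gamma)%:E < +oo)%E) :
  mpd P gamma =
    ((2 `^ (1 - gamma))%:E *
     \int[mu]_w (enorm (tsub (X w) (cond_expv mu X Y w)) `^ gamma)%:E)%E.
Proof.
have mX : measurable_fun setT X by [].
have mY : measurable_fun setT Y by [].
have mXY : measurable_fun setT (fun w => (X w, Y w)) by apply: measurable_fun_pair.
have mx i : measurable_fun setT (fun w : step_path R d => tnth w.1 i).
  exact: measurableT_comp (measurable_tnth i) measurable_fst.
have my i : measurable_fun setT (fun w : step_path R d => tnth w.2 i).
  exact: measurableT_comp (measurable_tnth i) measurable_snd.
pose XY w : vec R (d + d) := cat_tuple (X w) (Y w).
have XYl w i : tnth (XY w) (lshift d i) = tnth (X w) i by rewrite tnth_lshift.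
have XYr w i : tnth (XY w) (rshift d i) = tnth (Y w) i by rewrite tnth_rshift.
have mXYcat : measurable_fun setT XY.
  apply/measurable_fun_tnthP => i; case: (split_ordP i) => k ->.
    by apply: eq_measurable_fun (measurable_tnth_comp k mX) => w _ /=; rewrite XYl.
  by apply: eq_measurable_fun (measurable_tnth_comp k mY) => w _ /=; rewrite XYr.
(* a moment of order gamma >= 1 gives integrable coordinates *)
have imoment : mu.-integrable setT (fun w => (1 + enorm (XY w) `^ gamma)%:E).
  apply: (integrableD measurableT (f := cst 1%:E)
    (g := fun w => (enorm (XY w) `^ gamma)%:E)).
    exact: finite_measure_integrable_cst.
  apply/integrableP; split.
    by apply/measurable_EFinP; exact: measurable_enorm_powR.
  by under eq_integral do rewrite /= ger0_norm ?powR_ge0//.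
have icoord k : mu.-integrable setT (fun w => (tnth (XY w) k)%:E).
  apply: le_integrable imoment => //.
    by apply/measurable_EFinP; exact: measurable_tnth_comp.
  move=> w _; rewrite /= lee_fin [leRHS]ger0_norm ?addr_ge0 ?powR_ge0//.
  apply: le_trans (normr_tnth_le_enorm _ _) _; exact/le_1DpowR/enorm_ge0.
have iX i : P.-integrable setT (fun w => (tnth w.1 i)%:E).
  apply: (has_law_integrable mXY hXY); first exact/measurable_EFinP.
  by apply: eq_integrable (icoord (lshift d i)) => // w _ /=; rewrite XYl.
have iY i : P.-integrable setT (fun w => (tnth w.2 i)%:E).
  apply: (has_law_integrable mXY hXY); first exact/measurable_EFinP.
  by apply: eq_integrable (icoord (rshift d i)) => // w _ /=; rewrite XYr.
(* the regression function, one coordinate at a time *)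
have /choice[m mP] : forall i : 'I_d, exists k : vec R d -> R,
    measurable_fun setT k /\
    is_cond_exp P fst (fun w => tnth w.2 i) (k \o fst).
  by move=> i; have [k mk kP] := is_cond_exp_exists measurable_fst (iY i); exists k.
have mm i : measurable_fun setT (m i) by case: (mP i).
have {}mP i : is_cond_exp P fst (fun w => tnth w.2 i) (m i \o fst) by case: (mP i).
pose J := (\int[P]_w (2 * enorm (half_gap m w.1) `^ gamma)%:E)%E.
have mhg := measurable_half_gap mm.
have mJ : measurable_fun setT (fun w : step_path R d =>
    (2 * enorm (half_gap m w.1) `^ gamma)%:E).
  apply/measurable_EFinP; apply: measurable_funM => //.
  by apply: measurable_enorm_powR; exact: measurableT_comp mhg measurable_fst.
have J0 : (0 <= J)%E.
  by apply: integral_ge0 => w _; rewrite lee_fin mulr_ge0 ?powR_ge0.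
have -> : mpd P gamma = J.
  apply/eqP; rewrite eq_le; apply/andP; split.
    apply: le_of_vanishing_slack => // s s0 s1; exact: mpd_le.
  apply: le_ereal_inf_tmp => _ [Q Qmart <-].
  apply: le_ereal_inf_tmp => _ [Pi Pibc <-].
  exact: (half_gap_le_aw_cost hgamma mm mP Pibc Qmart).
have mcv : measurable_fun setT (fun w => half_gap m (X w)).
  exact: measurableT_comp mhg mX.
rewrite /J -(ge0_integral_has_law mXY hXY mJ); last first.
  by move=> w; rewrite lee_fin mulr_ge0 ?powR_ge0.
have mhX : measurable_fun setT (fun w => enorm (half_gap m (X w)) `^ gamma).
  exact: measurable_enorm_powR.
have iYmu i : mu.-integrable setT (EFin \o (fun w => tnth (Y w) i)).
  exact: (integrable_has_law mXY hXY (iY i)).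
have mcond : measurable_fun setT (fun w => cond_expv mu X Y w).
  apply: measurable_mktuple => i.
  have [_ /measurable_int + _ _] := is_cond_exp_cond_exp mX (iYmu i).
  by move/measurable_EFinP.
have condE : \forall w \ae mu, forall i : 'I_d,
    tnth (cond_expv mu X Y w) i = m i (X w).
  apply: filter_forall => i.
  have := cond_exp_ae mX (is_cond_exp_has_law mXY hXY measurable_fst (mP i)).
  by apply: filterS => w e; rewrite tnth_mktuple e.
have -> : (\int[mu]_w (enorm (tsub (X w) (cond_expv mu X Y w)) `^ gamma)%:E =
    \int[mu]_w ((2 `^ gamma)%:E * (enorm (half_gap m (X w)) `^ gamma)%:E))%E.
  apply: ge0_ae_eq_integral => //.
  - apply/measurable_EFinP; apply: measurable_enorm_powR.
    exact: measurable_tsub.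
  - by apply: measurable_funeM; exact/measurable_EFinP.
  - by move=> w _; rewrite lee_fin powR_ge0.
  - by move=> w _; rewrite -EFinM lee_fin mulr_ge0 ?powR_ge0.
  - apply: filterS condE => w cE _.
    rewrite -EFinM -powRM ?enorm_ge0//; congr (_ `^ _)%:E.
    rewrite -[2](ger0_norm (ler0n R 2)) -sqrtr_sqr -sqrtrM ?sqr_ge0//.
    congr Num.sqrt; rewrite mulr_sumr; apply: eq_bigr => i _.
    by rewrite tnth_tsub cE tnth_mktuple; field.
rewrite (ge0_integralZl mu measurableT); first last.
- by rewrite lee_fin powR_ge0.
- by move=> w _; rewrite lee_fin powR_ge0.
- exact/measurable_EFinP.
rewrite muleA -EFinM -powRD; last by rewrite pnatr_eq0 implybT.
rewrite subrK powRr1//.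
rewrite -(ge0_integralZl mu measurableT).
- by apply: eq_integral.
- exact/measurable_EFinP.
- by move=> w _; rewrite lee_fin powR_ge0.
- by rewrite lee_fin.
Qed.
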